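(* Let $r\in\mathbb{R}$ and $\lambda\in\mathbb{C}$ with $\lambda\neq1$. For every integer $n\ge 0$, \[ H_n^{(r)}(x\mid\lambda)=n!\sum_{k=0}^{n}\left\{\sum_{\substack{0\le l\le n-k\\ l\ \text{even}}}\frac{H_{n-k-l}^{(r)}(\lambda)}{k!\,(n-k-l)!\,\left(\frac{l}{2}\right)!\,2^{k+l}}\right\}H_k(x). \]
   Context: The Hermite polynomials $H_n(x)$ are defined by $e^{2xt-t^2}=\sum_{n\ge0}H_n(x)\frac{t^n}{n!}$. For $\lambda\in\mathbb{C}$, $\lambda\ne1$, and $r\in\mathbb{R}$, the Frobenius–Euler polynomials of order $r$ are defined by $\left(\frac{1-\lambda}{e^t-\lambda}\right)^r e^{xt}=\sum_{n\ge0}H_n^{(r)}(x\mid\lambda)\frac{t^n}{n!}$, and the Frobenius–Euler numbers of order $r$ are $H_n^{(r)}(\lambda)=H_n^{(r)}(0\mid\lambda)$. (These are distinct from the Hermite polynomials $H_n(x)$.) *)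

(* Defs.v *)
From HB Require Import structures.
From mathcomp Require Import all_boot all_order all_algebra.
From mathcomp Require Import zify boolp reals complex.

Set Implicit Arguments.
Unset Strict Implicit.
Unset Printing Implicit Defensive.

Import Order.TTheory GRing.Theory Num.Theory.
Local Open Scope ring_scope.

(* Formal power series in an indeterminate t; [fcoef f n] is the coefficient
   of t^n in f. *)
Record fps (A : Type) := Fps { fcoef : nat -> A }.

HB.instance Definition _ (A : Type) := gen_eqMixin (fps A).
HB.instance Definition _ (A : Type) := gen_choiceMixin (fps A).

Lemma fpsP (A : Type) (f g : fps A) :
  (forall n, fcoef f n = fcoef g n) -> f = g.
Proof. by case: f => f; case: g => g /= /funext ->. Qed.

Section FpsRing.
Variable A : comNzRingType.
Implicit Types f g h : fps A.

Definition fps_const (a : A) : fps A := Fps (fun n => if n is 0 then a else 0).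
Definition fps_t : fps A := Fps (fun n => (n == 1%N)%:R).
Definition fps_add f g : fps A := Fps (fun n => fcoef f n + fcoef g n).
Definition fps_opp f : fps A := Fps (fun n => - fcoef f n).
Definition fps_mul f g : fps A :=
  Fps (fun n => \sum_(i < n.+1) fcoef f i * fcoef g (n - i)).

Fact fps_addA : associative fps_add.
Proof. by move=> f g h; apply: fpsP => n /=; rewrite addrA. Qed.
Fact fps_addC : commutative fps_add.
Proof. by move=> f g; apply: fpsP => n /=; rewrite addrC. Qed.
Fact fps_add0 : left_id (fps_const 0) fps_add.
Proof. by move=> f; apply: fpsP => -[|n] /=; rewrite add0r. Qed.
Fact fps_addN : left_inverse (fps_const 0) fps_opp fps_add.
Proof. by move=> f; apply: fpsP => -[|n] /=; rewrite addNr. Qed.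

HB.instance Definition _ := GRing.isZmodule.Build (fps A)
  fps_addA fps_addC fps_add0 fps_addN.

Definition fps_trunc (N : nat) f : {poly A} := \poly_(i < N.+1) fcoef f i.

Fact coef_fps_trunc N f n : (n <= N)%N -> (fps_trunc N f)`_n = fcoef f n.
Proof. by move=> le_nN; rewrite coef_poly ltnS le_nN. Qed.

Fact coef_fps_truncM N f g n : (n <= N)%N ->
  fcoef (fps_mul f g) n = (fps_trunc N f * fps_trunc N g)`_n.
Proof.
move=> le_nN; rewrite coefM /=; apply: eq_bigr => i _.
rewrite !coef_fps_trunc //; first by apply: leq_trans le_nN; apply: leq_subr.
by apply: leq_trans le_nN; rewrite -ltnS.
Qed.

Fact fps_mulC : commutative fps_mul.
Proof. by move=> f g; apply: fpsP => n; rewrite !(@coef_fps_truncM n) // mulrC. Qed.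

Fact fps_mulA : associative fps_mul.
Proof.
move=> f g h; apply: fpsP => n.
transitivity (fps_trunc n f * fps_trunc n g * fps_trunc n h)`_n.
  rewrite -mulrA coefM /=; apply: eq_bigr => i _.
  have le_in : (i <= n)%N by rewrite -ltnS.
  rewrite coef_fps_trunc //; congr (_ * _).
  exact/coef_fps_truncM/leq_subr.
rewrite coefM /=; apply: eq_bigr => i _.
have le_in : (i <= n)%N by rewrite -ltnS.
by rewrite coef_fps_trunc ?leq_subr // -coef_fps_truncM.
Qed.

Fact fps_mul1 : left_id (fps_const 1) fps_mul.
Proof.
move=> f; apply: fpsP => n; rewrite /= big_ord_recl /= mul1r subn0.
by rewrite big1 ?addr0 // => i _; rewrite mul0r.
Qed.

Fact fps_mulDl : left_distributive fps_mul fps_add.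
Proof.
move=> f g h; apply: fpsP => n /=; rewrite -big_split /=.
by apply: eq_bigr => i _; rewrite mulrDl.
Qed.

Fact fps_1_neq0 : fps_const 1 != 0.
Proof.
by apply/eqP => /(congr1 (fun f => fcoef f 0)) /= /eqP; rewrite oner_eq0.
Qed.

HB.instance Definition _ := GRing.Zmodule_isComNzRing.Build (fps A)
  fps_mulA fps_mulC fps_mul1 fps_mulDl fps_1_neq0.

Fact fcoefM f g n :
  fcoef (f * g) n = \sum_(i < n.+1) fcoef f i * fcoef g (n - i).
Proof. by []. Qed.

Fact fcoefB f g n : fcoef (f - g) n = fcoef f n - fcoef g n.
Proof. by []. Qed.

Fact fcoef1 n : fcoef (1 : fps A) n = (n == 0%N)%:R.
Proof. by case: n. Qed.

Fact fcoef_sum (I : Type) (s : seq I) (P : pred I) (F : I -> fps A) n :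
  fcoef (\sum_(i <- s | P i) F i) n = \sum_(i <- s | P i) fcoef (F i) n.
Proof. by elim/big_rec2: _ => [|i a b _ <- //]; case: n. Qed.

Fact fcoefX_small f k n : fcoef f 0 = 0 -> (n < k)%N -> fcoef (f ^+ k) n = 0.
Proof.
move=> f0; elim: k n => // k IHk n lt_nk.
rewrite exprS fcoefM big_ord_recl f0 mul0r add0r big1 // => i _.
rewrite IHk ?mulr0 //= /bump add1n.
by have := ltn_ord i; lia.
Qed.
End FpsRing.

Section FpsFunctions.
Variable A : comUnitRingType.
Implicit Types f g : fps A.

(* If f has an invertible constant term c then f^-1 = c^-1 \sum_k (1 - f/c)^k;
   only the terms k <= n contribute to the coefficient of t^n. *)
Definition fps_unit : {pred fps A} := fun f => fcoef f 0 \is a GRing.unit.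
Definition fps_inv f : fps A :=
  if fps_unit f then
    Fps (fun n => (fcoef f 0)^-1 *
      \sum_(k < n.+1) fcoef ((1 - fps_const (fcoef f 0)^-1 * f) ^+ k) n)
  else f.

Fact fps_mulV : {in fps_unit, left_inverse 1 fps_inv *%R}.
Proof.
move=> f uf; have uf0 : fps_unit f := uf.
rewrite /fps_inv uf0; set c := (fcoef f 0)^-1; set u := 1 - _.
have constM a g n : fcoef (fps_const a * g) n = a * fcoef g n.
  rewrite fcoefM big_ord_recl subn0 big1 ?addr0 // => i _.
  by rewrite mul0r.
have u0 : fcoef u 0 = 0 by rewrite /u fcoefB constM mulVr // subrr.
apply: fpsP => n; rewrite fcoef1.
have fE g : fcoef (fps_const c * g * f) n = fcoef (g * (1 - u)) n.
  by rewrite /u opprB addrC subrK mulrA (mulrC g).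
transitivity (fcoef (fps_const c * (\sum_(k < n.+1) u ^+ k) * f) n).
  rewrite !fcoefM; apply: eq_bigr => i _; congr (_ * _).
  rewrite constM /= fcoef_sum; congr (_ * _).
  have le_in : (i < n.+1)%N by [].
  rewrite (big_ord_widen n.+1 (fun k => fcoef (u ^+ k) i)) //.
  rewrite big_mkcond /=; apply: eq_bigr => k _.
  by case: ifPn => //; rewrite -leqNgt => /fcoefX_small ->.
rewrite fE mulrC -opprB mulNr -subrX1 opprB fcoefB fcoef1.
by rewrite (fcoefX_small u0 (ltnSn n)) subr0.
Qed.

Fact fps_unitPl f g : g * f = 1 -> fps_unit f.
Proof.
move/(congr1 (fun h => fcoef h 0)); rewrite fcoefM big_ord1 fcoef1 /= => gf.
by apply/unitrPr; exists (fcoef g 0); rewrite mulrC.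
Qed.

Fact fps_inv_out : {in [predC fps_unit], fps_inv =1 id}.
Proof. by move=> f; rewrite inE /fps_inv => /negPf nuf; rewrite [fps_unit f]nuf. Qed.

HB.instance Definition _ := GRing.ComNzRing_hasMulInverse.Build (fps A)
  fps_mulV fps_unitPl fps_inv_out.

(* exp f = \sum_k f^k / k!, meaningful when f has zero constant term. *)
Definition fps_exp f : fps A :=
  Fps (fun n => \sum_(k < n.+1) (k`!%:R)^-1 * fcoef (f ^+ k) n).

(* log f = \sum_(k >= 1) (-1)^(k-1) (f - 1)^k / k, meaningful when f has
   constant term 1; k is shifted by one below. *)
Definition fps_log f : fps A :=
  Fps (fun n =>
    \sum_(k < n) (-1) ^+ k / k.+1%:R * fcoef ((f - 1) ^+ k.+1) n).

(* f^r = exp (r log f), meaningful when f has constant term 1: this is the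
   expansion at t = 0 of the branch of f^r taking the value 1 there. *)
Definition fps_pow f (r : A) : fps A := fps_exp (fps_const r * fps_log f).
End FpsFunctions.

(* The polynomial variable x is 'X and the series variable t is fps_t, so that
   generating functions are elements of C[x][[t]]. *)

(* exp (2xt - t^2) = \sum_n H_n(x) t^n / n! *)
Definition hermite (R : realType) (n : nat) : {poly R[i]} :=
  n`!%:R * fcoef (fps_exp (fps_const (2%:R * 'X) * fps_t _ - fps_t _ ^+ 2)) n.

(* ((1 - lambda) / (exp t - lambda))^r exp (xt)
     = \sum_n H_n^(r)(x | lambda) t^n / n! *)
Definition frobenius_euler (R : realType) (r : R) (lambda : R[i]) (n : nat) :
    {poly R[i]} :=
  n`!%:R * fcoef
    (fps_pow (fps_const (1 - lambda%:P) /
                (fps_exp (fps_t _) - fps_const lambda%:P)) (r%:C)%C%:P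
     * fps_exp (fps_const 'X * fps_t _)) n.

Definition frobenius_euler_number (R : realType) (r : R) (lambda : R[i])
    (n : nat) : R[i] :=
  (frobenius_euler r lambda n).[0].

(* Main.v *)
(* Since xt = (2x(t/2) - (t/2)^2) + t^2/4, the series exp(xt) is the Hermite
   generating function rescaled by t := t/2, times exp(t^2/4).  The power
   P = ((1 - lambda)/(exp t - lambda))^r has coefficients in C, so they are the
   Frobenius-Euler numbers divided by n!; expanding P exp(xt) along this
   factorization and comparing coefficients of t^n gives the formula. *)
From HB Require Import structures.
Require Import Defs.
From mathcomp Require Import all_boot all_order all_algebra.
From mathcomp Require Import reals complex zify ring.

Import GRing.Theory Num.Theory.
Local Open Scope ring_scope.

(** * Constant polynomials inside the polynomial ring *)

Definition poly_const {R : idomainType} : {pred {poly R}} :=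
  fun p => (size p <= 1)%N.

Lemma poly_constP {R : idomainType} (p : {poly R}) :
  reflect (exists c, p = c%:P) (p \in poly_const).
Proof.
apply: (iffP idP) => [/size1_polyC ->|[c ->]]; first by exists p`_0.
exact: size_polyC_leq1.
Qed.

Lemma poly_const_divring_closed (R : idomainType) :
  divring_closed (@poly_const R).
Proof.
split=> [|p q /poly_constP[a ->] /poly_constP[b ->]|
          p q /poly_constP[a ->] /poly_constP[b ->]].
- by apply/poly_constP; exists 1.
- by apply/poly_constP; exists (a - b); rewrite polyCB.
(* A non-unit of [{poly R}] is its own inverse by convention, so the quotient is constant in both
   cases. *)
apply/poly_constP; rewrite poly_invE; case: ifP => _.
  by exists (a * b^-1); rewrite coefC polyCM.
by exists (a * b); rewrite polyCM.
Qed.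

HB.instance Definition _ (R : idomainType) :=
  GRing.isDivringClosed.Build {poly R} (@poly_const R)
    (@poly_const_divring_closed R).

Lemma poly_const_horner (R : idomainType) (p : {poly R}) :
  p \in poly_const -> (p.[0])%:P = p.
Proof. by move=> /poly_constP[c ->]; rewrite hornerC. Qed.

(** * Exponentials of formal power series *)

Section FpsExp.
Context {A : comUnitRingType}.
Implicit Types (a b : A) (f g : fps A).

Lemma fcoefD f g n : fcoef (f + g) n = fcoef f n + fcoef g n.
Proof. by []. Qed.

Lemma fcoef0 n : fcoef (0 : fps A) n = 0.
Proof. by case: n. Qed.

Lemma fcoef_constM a f n : fcoef (fps_const a * f) n = a * fcoef f n.
Proof.
rewrite fcoefM big_ord_recl subn0 big1 ?addr0 // => i _.
by rewrite mul0r.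
Qed.

Lemma fcoef_tX m n : fcoef (fps_t A ^+ m) n = (n == m)%:R.
Proof.
elim: m n => [|m IHm] n; first by rewrite expr0 fcoef1.
rewrite exprS fcoefM; case: n => [|n].
  by rewrite big_ord1 /= mul0r.
rewrite big_ord_recl mul0r add0r big_ord_recl /= mul1r IHm.
by rewrite subSS subn0 eqSS big1 ?addr0 // => i _; rewrite mul0r.
Qed.

Lemma fps_constM a b : fps_const (a * b) = fps_const a * fps_const b.
Proof. by apply: fpsP => -[|n]; rewrite fcoef_constM //= mulr0. Qed.

Lemma fps_constX a m : fps_const (a ^+ m) = fps_const a ^+ m.
Proof. by elim: m => // m IHm; rewrite !exprS fps_constM IHm. Qed.

(** In each term of the convolution, either the left index is below [k] or the right one is below
    [j]. *)
Lemma fcoefXM_small f g k j n : fcoef f 0 = 0 -> fcoef g 0 = 0 ->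
  (n < k + j)%N -> fcoef (f ^+ k * g ^+ j) n = 0.
Proof.
move=> f0 g0 lt_n; rewrite fcoefM big1 // => i _.
have := ltn_ord i; case: (ltnP i k) => [lt_ik _|le_ki lt_in].
  by rewrite (fcoefX_small f0) // mul0r.
by rewrite [X in _ * X](fcoefX_small g0) ?mulr0 //; lia.
Qed.

Lemma fcoefMn f k n : fcoef (f *+ k) n = fcoef f n *+ k.
Proof. by elim: k => [|k IHk]; rewrite ?fcoef0 // !mulrS fcoefD IHk. Qed.

Lemma fcoef_exp f n :
  fcoef (fps_exp f) n = \sum_(k < n.+1) (k`!%:R)^-1 * fcoef (f ^+ k) n.
Proof. by []. Qed.

(** A bound [N] common to all [n <= N] lets products of exponentials be computed with finite sums of
    fixed length. *)
Lemma fcoef_exp_widen f N n : fcoef f 0 = 0 -> (n <= N)%N ->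
  fcoef (fps_exp f) n =
  fcoef (\sum_(k < N.+1) fps_const (k`!%:R)^-1 * f ^+ k) n.
Proof.
move=> f0 le_nN; rewrite fcoef_sum fcoef_exp.
rewrite (big_ord_widen N.+1 (fun k => (k`!%:R)^-1 * fcoef (f ^+ k) n)) //.
rewrite big_mkcond; apply: eq_bigr => k _; rewrite fcoef_constM.
by case: ltnP => // lt_nk; rewrite (fcoefX_small f0) ?mulr0.
Qed.

(** The binomial theorem yields a sum over the triangle [k + j <= n]; the rest of the square
    contributes nothing, for reasons of order, and the square sum factors. *)
Lemma fps_expD f g : (forall n, (n`!%:R : A) \is a GRing.unit) ->
  fcoef f 0 = 0 -> fcoef g 0 = 0 ->
  fps_exp (f + g) = fps_exp f * fps_exp g.
Proof.
move=> unit_fact f0 g0; apply: fpsP => n.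
have fg0 : fcoef (f + g) 0 = 0 by rewrite fcoefD f0 g0 addr0.
pose c k j : A := (k`!%:R)^-1 * (j`!%:R)^-1.
pose G k j := c k j * fcoef (f ^+ k * g ^+ j) n.
have G0 k j : (n < k + j)%N -> G k j = 0.
  by move=> ?; rewrite /G fcoefXM_small ?mulr0.
transitivity (\sum_(0 <= m < n.+1)
                \sum_(0 <= j < n.+1 | (j <= m)%N) G (m - j)%N j).
  rewrite (@fcoef_exp_widen _ n) // fcoef_sum big_mkord.
  apply: eq_bigr => m _.
  rewrite fcoef_constM exprDn fcoef_sum mulr_sumr.
  rewrite -(big_mkord xpredT (fun i => (m`!%:R)^-1 *
     fcoef (f ^+ (m - i) * g ^+ i *+ 'C(m, i)) n)).
  rewrite (big_nat_widen 0 m.+1 n.+1) //.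
  apply: eq_big => j; first by rewrite ltnS.
  (* Multiplying by [m!] reduces the claim to ['C(m, j) * (j! * (m - j)!) = m!]. *)
  rewrite ltnS fcoefMn => le_jm; apply: (mulrI (unit_fact m)).
  rewrite mulVKr // /G /c -[in RHS](bin_fact le_jm) !natrM -!mulrA.
  by rewrite !mulVKr // mulr_natl.
rewrite (exchange_big_dep_nat xpredT) //=.
(* Substituting [k = m - j], then letting [k] run up to [n]: the added terms have [k + j > n] and
   vanish by [G0]. *)
transitivity (\sum_(0 <= j < n.+1) \sum_(0 <= k < n.+1) G k j).
  apply: eq_big_nat => j /andP[_ lt_jn].
  rewrite -(big_nat_widenl j 0 _ xpredT) // -{1}(add0n j) big_addn.
  rewrite (big_nat_widen 0 _ n.+1) ?leq_subr // big_mkcond /=.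
  apply: eq_big_nat => k _; rewrite addnK.
  by case: ltnP => // le; rewrite G0 //; lia.
rewrite exchange_big_nat big_mkord.
transitivity (fcoef ((\sum_(k < n.+1) fps_const (k`!%:R)^-1 * f ^+ k) *
                     (\sum_(j < n.+1) fps_const (j`!%:R)^-1 * g ^+ j)) n).
  rewrite mulr_suml fcoef_sum; apply: eq_bigr => k _.
  rewrite big_mkord mulr_sumr fcoef_sum; apply: eq_bigr => j _.
  by rewrite mulrACA -fps_constM fcoef_constM.
rewrite !fcoefM; apply: eq_bigr => i _.
by rewrite -!fcoef_exp_widen ?leq_subr // -ltnS.
Qed.

(** The substitution [t := a t]. *)
Definition fps_rescale a f : fps A := Fps (fun n => a ^+ n * fcoef f n).

Lemma fcoef_rescale a f n : fcoef (fps_rescale a f) n = a ^+ n * fcoef f n.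
Proof. by []. Qed.

Lemma fps_rescaleX a f k : fps_rescale a (f ^+ k) = fps_rescale a f ^+ k.
Proof.
elim: k => [|k IHk].
  by apply: fpsP => -[|n]; rewrite fcoef_rescale fcoef1 ?mul1r ?mulr0.
rewrite !exprS -IHk; apply: fpsP => n; rewrite fcoef_rescale !fcoefM mulr_sumr.
apply: eq_bigr => i _; rewrite !fcoef_rescale mulrACA -exprD subnKC //.
by rewrite -ltnS.
Qed.

Lemma fps_rescale_exp a f :
  fps_rescale a (fps_exp f) = fps_exp (fps_rescale a f).
Proof.
apply: fpsP => n; rewrite fcoef_rescale !fcoef_exp mulr_sumr.
by apply: eq_bigr => k _; rewrite -fps_rescaleX fcoef_rescale mulrCA.
Qed.

(** The [k]-th power of the argument is a monomial of degree [m * k], so at most one term of the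
    exponential reaches degree [n]. *)
Lemma fcoef_exp_monomial a m n : (0 < m)%N ->
  fcoef (fps_exp (fps_const a * fps_t A ^+ m)) n =
  if (m %| n)%N then a ^+ (n %/ m) / ((n %/ m)`!)%:R else 0.
Proof.
move=> m_gt0; have coefX k j :
    fcoef ((fps_const a * fps_t A ^+ m) ^+ k) j = a ^+ k * (j == m * k)%N%:R.
  by rewrite exprMn -fps_constX -exprM fcoef_constM fcoef_tX.
rewrite fcoef_exp; case: ifPn => [/dvdnP[k]|m_ndvd_n].
  rewrite mulnC => n_mk.
  have lt_k : (k < n.+1)%N by rewrite ltnS n_mk leq_pmull.
  have -> : (n %/ m)%N = k by rewrite n_mk mulKn.
  rewrite (bigD1 (Ordinal lt_k)) //= coefX -n_mk eqxx mulr1 mulrC.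
  rewrite big1 ?addr0 // => j neq_jk; rewrite coefX.
  have /negPf -> : n != (m * j)%N.
    apply: contraNneq neq_jk => /esym/eqP.
    by rewrite [X in _ == X]n_mk eqn_pmul2l.
  by rewrite !mulr0.
rewrite big1 // => k _; rewrite coefX (_ : (n == _) = false) ?mulr0 //.
by apply: contraNF m_ndvd_n => /eqP ->; rewrite dvdn_mulr.
Qed.

(** * Series with coefficients in a division-closed subset *)

Context (S : divringClosed A).

(** With [S] the constant polynomials, this says that a series in [t] does not involve [x]. *)
Definition fps_over f := forall n, fcoef f n \in S.

Lemma fps_overM f g : fps_over f -> fps_over g -> fps_over (f * g).
Proof.
by move=> Sf Sg n; rewrite fcoefM; apply: rpred_sum => i _; apply: rpredM.
Qed.

Lemma fps_over_const a : a \in S -> fps_over (fps_const a).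
Proof. by move=> Sa [|n] //=; apply: rpred0. Qed.

Lemma fps_over_t : fps_over (fps_t A).
Proof. by move=> n; apply: rpred_nat. Qed.

Lemma fps_overB f g : fps_over f -> fps_over g -> fps_over (f - g).
Proof. by move=> Sf Sg n; rewrite fcoefB; apply: rpredB. Qed.

Lemma fps_over1 : fps_over 1.
Proof. exact/fps_over_const/rpred1. Qed.

Lemma fps_overX f k : fps_over f -> fps_over (f ^+ k).
Proof.
move=> Sf; elim: k => [|k IHk]; first exact: fps_over1.
by rewrite exprS; apply: fps_overM.
Qed.

Lemma fps_over_exp f : fps_over f -> fps_over (fps_exp f).
Proof.
move=> Sf n; apply: rpred_sum => k _.
by apply: rpredM; [rewrite rpredV rpred_nat | apply: fps_overX].
Qed.

Lemma fps_over_log f : fps_over f -> fps_over (fps_log f).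
Proof.
move=> Sf n; apply: rpred_sum => k _; apply: rpredM.
  by apply: rpred_div; [rewrite rpredX ?rpredN1 | apply: rpred_nat].
exact/fps_overX/fps_overB/fps_over1.
Qed.

Lemma fps_overV f : fps_over f -> fps_over f^-1.
Proof.
move=> Sf; rewrite [f^-1](_ : _ = fps_inv f) // /fps_inv.
have Sf0 : (fcoef f 0)^-1 \in S by rewrite rpredV.
(* When the constant term is not invertible, [fps_inv f] is [f] itself and [Sf] applies. *)
case: ifP => // _ n; apply: rpredM => //; apply: rpred_sum => k _.
apply/fps_overX/fps_overB; first exact: fps_over1.
exact/fps_overM/Sf/fps_over_const.
Qed.

Lemma fps_over_pow f a : a \in S -> fps_over f -> fps_over (fps_pow f a).
Proof.
by move=> Sa Sf; apply/fps_over_exp/fps_overM/fps_over_log/Sf/fps_over_const.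
Qed.

End FpsExp.

(** * Polynomials in [x] over a field of characteristic 0: invertible integers and the Hermite
    expansion *)

Lemma natr_poly_unit (F : numFieldType) (m : nat) :
  (0 < m)%N -> (m%:R : {poly F}) \is a GRing.unit.
Proof.
move=> m_gt0; have -> : (m%:R : {poly F}) = (m%:R)%:P by rewrite rmorph_nat.
by rewrite rmorph_unit // unitfE pnatr_eq0 -lt0n.
Qed.

Lemma natr_polyV (F : numFieldType) (m : nat) :
  (0 < m)%N -> (m%:R : {poly F})^-1 = (m%:R^-1)%:P.
Proof.
move=> m_gt0; have -> : (m%:R : {poly F}) = (m%:R)%:P by rewrite rmorph_nat.
by rewrite -rmorphV // unitfE pnatr_eq0 -lt0n.
Qed.

Section HermiteExpansion.
Context {F : numFieldType}.
Implicit Type P : fps {poly F}.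

(** At [x = 0] the factor [exp(xt)] becomes 1. This relates the Frobenius-Euler numbers to the
    coefficients of the power [P]. *)
Lemma horner0_fcoef_mul_expX P n : fps_over poly_const P ->
  (fcoef (P * fps_exp (fps_const 'X * fps_t _)) n).[0] = (fcoef P n).[0].
Proof.
move=> P_const; rewrite fcoefM horner_sum.
have E0 m :
    (fcoef (fps_exp (fps_const 'X * fps_t {poly F})) m).[0] = (m == 0%N)%:R.
  rewrite -[fps_t _]expr1 fcoef_exp_monomial // dvd1n divn1.
  rewrite natr_polyV ?fact_gt0 // hornerM hornerXn hornerC expr0n.
  by case: m => [|m]; rewrite ?mul0r // fact0 invr1 mulr1.
rewrite big_ord_recr big1 => [|i _].
  by rewrite [LHS]add0r hornerM subnn E0 mulr1.
by rewrite hornerM E0 subn_eq0 leqNgt [(_ < n)%N](ltn_ord i) mulr0.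
Qed.

Definition hermite_gf : fps {poly F} :=
  fps_exp (fps_const (2%:R * 'X) * fps_t _ - fps_t _ ^+ 2).

Lemma expX_hermite_gf :
  let c : {poly F} := (2%:R^-1)%:P in
  fps_exp (fps_const 'X * fps_t _) =
  fps_rescale c hermite_gf * fps_exp (fps_const (c ^+ 2) * fps_t _ ^+ 2).
Proof.
move=> c; have tX0 (a : {poly F}) m :
    fcoef (fps_const a * fps_t _ ^+ m.+1) 0 = 0.
  by rewrite fcoef_constM fcoef_tX mulr0.
rewrite fps_rescale_exp -fps_expD.
- congr fps_exp; apply: fpsP => n.
  rewrite fcoefD fcoef_rescale fcoefB -[fps_t {poly F}]expr1 -exprM.
  rewrite !fcoef_constM !fcoef_tX.
  (* Only degrees 1 and 2 matter: in degree 2, [- c ^+ 2] and [c ^+ 2] cancel; in degree 1,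
     [c * (2 * 'X)] is ['X]. *)
  case: eqP => [->|_]; last first.
    by case: eqP => [->|_] /=; rewrite !(mulr0, mulr1); ring.
  rewrite !mulr1 subr0 mulr0 addr0 expr1 mulrA -(rmorph_nat (@polyC F)) -polyCM.
  by rewrite mulVf ?pnatr_eq0 // mul1r.
- by move=> m; apply/natr_poly_unit/fact_gt0.
- by rewrite fcoef_rescale fcoefB -{1}[fps_t _]expr1 tX0 fcoef_tX subr0 mulr0.
- exact: tX0.
Qed.

(** A double convolution: degree [k] comes from the Hermite factor, [l] from [exp(t^2/4)], which is
    even, and [n - k - l] from [P]. *)
Lemma fcoef_mul_expX P n : fps_over poly_const P ->
  fcoef (P * fps_exp (fps_const 'X * fps_t _)) n =
  \sum_(k < n.+1)
    (\sum_(l < (n - k).+1 | ~~ odd l)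
       (fcoef P (n - k - l)).[0] / ((l./2)`! * 2 ^ (k + l))%:R)
    *: fcoef hermite_gf k.
Proof.
move=> P_const; rewrite expX_hermite_gf mulrCA fcoefM.
apply: eq_bigr => k _; rewrite fcoef_rescale mulrAC -mul_polyC; congr (_ * _).
rewrite mulrC [P * _]mulrC fcoefM mulr_suml rmorph_sum.
rewrite [RHS]big_mkcond; apply: eq_bigr => l _.
rewrite fcoef_exp_monomial // dvdn2.
case: ifP => even_l; last by rewrite !mul0r.
(* As the coefficients of [P] are constant, both sides are constant polynomials and the identity
   descends to [F]. *)
rewrite -[fcoef P _]poly_const_horner // natr_polyV ?fact_gt0 //.
rewrite -!rmorphXn -!rmorphM; congr _%:P.
(* For even [l], the factor [(1/4)^(l/2)] is [2^(-l)]; it joins the [2^(-k)] of the rescaling. *)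
have -> : (k + l = k + 2 * l./2)%N.
  by rewrite -[in LHS](odd_double_half l) (negPf even_l) mul2n.
rewrite divn2 natrM natrX exprD exprM !invfM -!exprVn hornerC.
ring.
Qed.

End HermiteExpansion.

Theorem theorem3 (R : realType) (r : R) (lambda : R[i])
    (hlambda : lambda != 1) (n : nat) :
  frobenius_euler r lambda n =
    n`!%:R *:
      \sum_(k < n.+1)
        (\sum_(l < (n - k).+1 | ~~ odd l)
           frobenius_euler_number r lambda (n - k - l) /
             (k`! * (n - k - l)`! * (l./2)`! * 2 ^ (k + l))%:R)
        *: hermite R k.
Proof.
(* The power is built from [exp t] and constants only, without [x]. *)
have P_const : fps_over poly_const
    (fps_pow (fps_const (1 - lambda%:P) /
                (fps_exp (fps_t _) - fps_const lambda%:P)) (r%:C)%C%:P).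
  have const_over (c : R[i]) : fps_over poly_const (fps_const c%:P).
    exact/fps_over_const/size_polyC_leq1.
  apply: fps_over_pow; first exact: size_polyC_leq1.
  apply: fps_overM; first by rewrite -polyC1 -polyCB; apply: const_over.
  exact/fps_overV/fps_overB/const_over/fps_over_exp/fps_over_t.
have fact_neq0 m : m`!%:R != 0 :> R[i] by rewrite pnatr_eq0 -lt0n fact_gt0.
rewrite /frobenius_euler_number /frobenius_euler fcoef_mul_expX //.
rewrite -(rmorph_nat (@polyC R[i])) mul_polyC; congr (_ *: _).
apply: eq_bigr => k _; rewrite /hermite -(rmorph_nat (@polyC R[i])) mul_polyC.
rewrite scalerA mulr_suml; congr (_ *: _); apply: eq_bigr => l _.
(* The number of index [n - k - l] is [(n - k - l)!] times a coefficient of the power; this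
   factorial and the [k!] in [hermite] cancel the denominators. *)
rewrite hornerM -(rmorph_nat (@polyC R[i])) hornerC horner0_fcoef_mul_expX //.
move: (fcoef _ _).[0] => p; rewrite !natrM.
have pow_neq0 : (2 ^ (k + l))%:R != 0 :> R[i] by rewrite pnatr_eq0 expn_eq0.
move: (fact_neq0 k) (fact_neq0 (n - k - l)%N) (fact_neq0 l./2) pow_neq0.
(* Generalized to arbitrary nonzero scalars, the factorials and the power of 2 leave a plain
   identity of fractions. *)
move: k`!%:R (n - k - l)`!%:R l./2`!%:R (2 ^ (k + l))%:R => u v w z u0 v0 w0 z0.
by field; rewrite u0 v0 w0 z0.
Qed.
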